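(* Let $T$ be a complete first order theory with countable signature and models of cardinality $>1$. In the big model $\mathcal N$ of $T^R$, the relation $\perp^{a\omega}$ has finite character: for all small $A,B,C\subseteq\mathcal K$, if $A_0\perp^{a\omega}_C B$ for every finite $A_0\subseteq A$, then $A\perp^{a\omega}_C B$.
   Context: Fix an uncountable inaccessible cardinal $\upsilon$; small means cardinality $<\upsilon$. $\mathcal M$ is the big model of $T$ (saturated, finite or of cardinality $\upsilon$). $T^R$ (the randomization of $T$) is the complete continuous theory in the two-sorted signature with a sort $\mathbb K$ (random elements) and a sort $\mathbb B$ (events), a function symbol $[\![\varphi(\cdot)]\!]$ of sort $\mathbb K^n\to\mathbb B$ for each first order formula $\varphi$ with $n$ free variables, a $[0,1]$-valued predicate $\mu$ on $\mathbb B$, Boolean operations on $\mathbb B$, and metrics $d_{\mathbb K},d_{\mathbb B}$; its big model $\mathcal N=(\mathcal K,\mathcal E)$ (saturated, cardinality $\upsilon$) is the reduction of a pre-structure $(\mathcal J,\mathcal F)$ of functions $\Omega\to M$ and events over a complete atomless probability space $(\Omega,\mathcal F,\mu)$, with $[\![\psi(\vec a)]\!]=\{\omega:\mathcal M\models\psi(\vec a(\omega))\}$, $\mathcal F$ consisting exactly of such events, the fullness property that for each $\theta(u,\vec v)$ and $\vec b$ some $a$ has $[\![\theta(a,\vec b)]\!]=[\![\exists u\,\theta(u,\vec b)]\!]$, $d_{\mathbb K}(a,b)=\mu[\![a\ne b]\!]$, $d_{\mathbb B}(\mathsf B,\mathsf C)=\mu(\mathsf B\triangle\mathsf C)$. Each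 $\mathbf b\in\mathcal K$ has a fixed representative $b\in\mathcal J$; for $A\subseteq\mathcal K$, $A(\omega)=\{a(\omega):\mathbf a\in A\}$. $A\perp^{a\omega}_C B$ means: for all countable $A'\subseteq A$, $B'\subseteq B$, $C'\subseteq C$ there is a countable $D$ with $C'\subseteq D\subseteq C$ such that the set $\{\omega:\operatorname{acl}^{\mathcal M}(A'(\omega)\cup D(\omega))\cap\operatorname{acl}^{\mathcal M}(B'(\omega)\cup D(\omega))=\operatorname{acl}^{\mathcal M}(D(\omega))\}$ (which belongs to $\mathcal F$) has $\mu$-measure $1$. *)

(* Defs.v *)
From HB Require Import structures.
From mathcomp Require Import all_boot all_order all_algebra.
From mathcomp Require Import all_classical all_reals all_analysis.
Set Implicit Arguments.
Unset Strict Implicit.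
Unset Printing Implicit Defensive.
Import Order.TTheory GRing.Theory Num.Theory numFieldNormedType.Exports.
Local Open Scope classical_set_scope.
Local Open Scope card_scope.
Local Open Scope ring_scope.

(** * Cardinals

    The cardinal upsilon is represented by a type [U] of that cardinality. *)

Definition card_lt {X Y : Type} (A : set X) (B : set Y) : Prop :=
  (A #<= B) /\ ~ (B #<= A).

Definition uncountable_inaccessible (U : Type) : Prop :=
  [/\ ~ countable [set: U],
      (* strong limit *)
      forall X : set U, card_lt X [set: U] ->
        card_lt [set Y : set U | Y `<=` X] [set: U]
    & (* regular *)
      forall (I : set U) (F : U -> set U), card_lt I [set: U] ->
        (forall i, I i -> card_lt (F i) [set: U]) ->
        card_lt (\bigcup_(i in I) F i) [set: U]].

Definition small (U : Type) {X : Type} (A : set X) : Prop :=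
  card_lt A [set: U].

(** * First order logic *)

Record fo_sig := FoSig {
  fun_sym : Type;
  fun_ar : fun_sym -> nat;
  rel_sym : Type;
  rel_ar : rel_sym -> nat }.

Definition countable_sig (L : fo_sig) : Prop :=
  countable [set: fun_sym L] /\ countable [set: rel_sym L].

Section FirstOrder.
Variable L : fo_sig.

(* [fo_term n], [fo_form n]: free variables among v_0, ..., v_(n-1). *)
Inductive fo_term (n : nat) : Type :=
| TVar of 'I_n
| TApp (f : fun_sym L) of ('I_(fun_ar f) -> fo_term n).

(* A quantifier binds the variable v_0 of its body; the variable v_(i+1) of
   the body is the variable v_i outside. *)
Inductive fo_form : nat -> Type :=
| FEq n : fo_term n -> fo_term n -> fo_form n
| FRel n (r : rel_sym L) : ('I_(rel_ar r) -> fo_term n) -> fo_form n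
| FNot n : fo_form n -> fo_form n
| FAnd n : fo_form n -> fo_form n -> fo_form n
| FOr n : fo_form n -> fo_form n -> fo_form n
| FEx n : fo_form n.+1 -> fo_form n
| FAll n : fo_form n.+1 -> fo_form n.

Record fo_struct := FoStruct {
  carrier :> Type;
  carrier_inh : inhabited carrier;
  fun_int : forall f : fun_sym L, ('I_(fun_ar f) -> carrier) -> carrier;
  rel_int : forall r : rel_sym L, ('I_(rel_ar r) -> carrier) -> Prop }.

End FirstOrder.

Arguments FEq {L n}.
Arguments FRel {L n}.
Arguments FNot {L n}.
Arguments FAnd {L n}.
Arguments FOr {L n}.
Arguments FEx {L n}.
Arguments FAll {L n}.
Arguments TVar {L n}.
Arguments fun_int {L} M f _ : rename.
Arguments rel_int {L} M r _ : rename.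

(* The tuple (a, v_0, ..., v_(n-1)). *)
Definition scons {X : Type} {n : nat} (a : X) (v : 'I_n -> X) : 'I_n.+1 -> X :=
  fun i => if unlift ord0 i is Some j then v j else a.

(* The tuple (v_0, ..., v_(m-1), w_0, ..., w_(n-1)). *)
Definition tcat {X : Type} {m n : nat} (v : 'I_m -> X) (w : 'I_n -> X) :
    'I_(m + n) -> X :=
  fun i => match fintype.split i with inl j => v j | inr j => w j end.

Fixpoint tval (L : fo_sig) (M : fo_struct L) n (v : 'I_n -> M)
    (t : fo_term L n) : M :=
  match t with
  | TVar i => v i
  | TApp f ts => fun_int M f (fun j => tval v (ts j))
  end.

Fixpoint sat (L : fo_sig) (M : fo_struct L) n (phi : fo_form L n) :
    ('I_n -> M) -> Prop :=
  match phi in fo_form _ n return ('I_n -> M) -> Prop with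
  | FEq _ s t => fun v => tval v s = tval v t
  | FRel _ r ts => fun v => rel_int M r (fun j => tval v (ts j))
  | FNot _ p => fun v => ~ sat p v
  | FAnd _ p q => fun v => sat p v /\ sat q v
  | FOr _ p q => fun v => sat p v \/ sat q v
  | FEx _ p => fun v => exists a, sat p (scons a v)
  | FAll _ p => fun v => forall a, sat p (scons a v)
  end.

(* The formula v_0 = v_1. *)
Definition eq_form (L : fo_sig) : fo_form L 2 :=
  FEq (TVar ord0) (TVar ord_max).

Definition valid (L : fo_sig) n (phi : fo_form L n) : Prop :=
  forall (M : fo_struct L) (v : 'I_n -> M), sat phi v.

Definition fo_theory (L : fo_sig) : Type := set (fo_form L 0).

Definition sentence_true (L : fo_sig) (M : fo_struct L) (phi : fo_form L 0) :
    Prop :=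
  forall v : 'I_0 -> M, sat phi v.

Definition models (L : fo_sig) (M : fo_struct L) (T : fo_theory L) : Prop :=
  forall phi, T phi -> sentence_true M phi.

Definition entails (L : fo_sig) (T : fo_theory L) (phi : fo_form L 0) : Prop :=
  forall M : fo_struct L, models M T -> sentence_true M phi.

Definition complete_theory (L : fo_sig) (T : fo_theory L) : Prop :=
  (exists M : fo_struct L, models M T) /\
  (forall phi, entails T phi \/ entails T (FNot phi)).

(* A formula phi(u, b) in the variable u = v_0, with parameters b in M. *)
Record pform (L : fo_sig) (M : fo_struct L) := PForm {
  pf_arity : nat;
  pf_form : fo_form L pf_arity.+1;
  pf_par : 'I_pf_arity -> M }.
Arguments pf_par {L M} p _.

Definition pform_over (L : fo_sig) (M : fo_struct L) (A : set M) :
    set (pform M) :=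
  [set p | forall i, A (pf_par p i)].

Definition psat (L : fo_sig) (M : fo_struct L) (p : pform M) (x : M) : Prop :=
  sat (pf_form p) (scons x (pf_par p)).

Definition fo_saturated (L : fo_sig) (M : fo_struct L) : Prop :=
  forall A : set M, card_lt A [set: M] ->
  forall G : set (pform M), G `<=` pform_over A ->
    (forall G0, G0 `<=` G -> finite_set G0 ->
       exists x, forall p, G0 p -> psat p x) ->
    exists x, forall p, G p -> psat p x.

Definition fo_big_model (U : Type) (L : fo_sig) (T : fo_theory L)
    (M : fo_struct L) : Prop :=
  [/\ models M T, fo_saturated M
    & finite_set [set: M] \/ ([set: M] #= [set: U])].

Definition acl (L : fo_sig) (M : fo_struct L) (A : set M) : set M :=
  [set x | exists p : pform M,
     [/\ pform_over A p, psat p x & finite_set [set y | psat p y]]].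

(** * Continuous structures for the randomization signature *)

Record rstruct (R : realType) (L : fo_sig) := RStruct {
  relt : Type;  (* random elements *)
  revt : Type;  (* events *)
  rbrk : forall n, fo_form L n -> ('I_n -> relt) -> revt;  (* [[phi(.)]] *)
  rmu : revt -> R;
  rtop : revt;
  rbot : revt;
  rmeet : revt -> revt -> revt;
  rjoin : revt -> revt -> revt;
  rneg : revt -> revt;
  rdK : relt -> relt -> R;
  rdB : revt -> revt -> R }.

Section Metric.
Variables (R : realType) (X : Type) (d : X -> X -> R).

Definition bounded_metric : Prop :=
  [/\ forall x y, 0 <= d x y <= 1,
      forall x y, d x y = 0 <-> x = y,
      forall x y, d x y = d y x
    & forall x y z, d x z <= d x y + d y z].

Definition cauchy_complete : Prop :=
  forall u : nat -> X,
    (forall e : R, 0 < e ->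
       exists N, forall m n, (N <= m)%N -> (N <= n)%N -> d (u m) (u n) < e) ->
    exists l, d (u n) l @[n --> \oo] --> (0 : R).

End Metric.

(* Every symbol of the randomization signature is 1-Lipschitz in each of its
   arguments. *)
Definition metric_structure (R : realType) (L : fo_sig) (N : rstruct R L) :
    Prop :=
  [/\ (bounded_metric (@rdK _ _ N) /\ cauchy_complete (@rdK _ _ N)),
      (bounded_metric (@rdB _ _ N) /\ cauchy_complete (@rdB _ _ N)),
      inhabited (relt N),
      ((forall b : revt N, 0 <= rmu b <= 1) /\
       (forall b c : revt N, `|rmu b - rmu c| <= rdB b c))
    & [/\ forall n (phi : fo_form L n) (x y : 'I_n -> relt N),
            rdB (rbrk phi x) (rbrk phi y) <= \sum_i rdK (x i) (y i),
          forall b c b' c' : revt N,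
            rdB (rmeet b c) (rmeet b' c') <= rdB b b' + rdB c c',
          forall b c b' c' : revt N,
            rdB (rjoin b c) (rjoin b' c') <= rdB b b' + rdB c c'
        & forall b c : revt N, rdB (rneg b) (rneg c) <= rdB b c]].

(** ** Continuous formulas *)

Definition cube {R : realType} {m : nat} : set 'rV[R]_m :=
  [set v | forall i, 0 <= v ord0 i <= 1].

Record connective (R : realType) (m : nat) := Connective {
  conn_fun :> 'rV[R]_m -> R;
  conn_cont : {within cube, continuous conn_fun};
  conn_range : forall v, cube v -> 0 <= conn_fun v <= 1 }.

(* [cterm k l], [cform k l]: k free variables for random elements and l free
   variables for events. The sort of random elements has no function symbols
   into it, so its only terms are variables. *)
Inductive cterm (L : fo_sig) (k l : nat) : Type :=
| CVar of 'I_l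
| CEv n of fo_form L n & ('I_n -> 'I_k)
| CTop
| CBot
| CMeet of cterm L k l & cterm L k l
| CJoin of cterm L k l & cterm L k l
| CNeg of cterm L k l.

Inductive cform (R : realType) (L : fo_sig) : nat -> nat -> Type :=
| CMu k l : cterm L k l -> cform R L k l
| CDK k l : 'I_k -> 'I_k -> cform R L k l
| CDB k l : cterm L k l -> cterm L k l -> cform R L k l
| CConn k l m : connective R m -> ('I_m -> cform R L k l) -> cform R L k l
| CSupK k l : cform R L k.+1 l -> cform R L k l
| CInfK k l : cform R L k.+1 l -> cform R L k l
| CSupB k l : cform R L k l.+1 -> cform R L k l
| CInfB k l : cform R L k l.+1 -> cform R L k l.

Fixpoint ctval (R : realType) (L : fo_sig) (N : rstruct R L) k l
    (x : 'I_k -> relt N) (y : 'I_l -> revt N) (t : cterm L k l) : revt N :=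
  match t with
  | CVar i => y i
  | CEv _ phi s => rbrk phi (fun i => x (s i))
  | CTop => rtop N
  | CBot => rbot N
  | CMeet s t => rmeet (ctval x y s) (ctval x y t)
  | CJoin s t => rjoin (ctval x y s) (ctval x y t)
  | CNeg s => rneg (ctval x y s)
  end.

Fixpoint cval (R : realType) (L : fo_sig) (N : rstruct R L) k l
    (phi : cform R L k l) : ('I_k -> relt N) -> ('I_l -> revt N) -> R :=
  match phi in cform _ _ k l return ('I_k -> relt N) -> ('I_l -> revt N) -> R
  with
  | CMu _ _ t => fun x y => rmu (ctval x y t)
  | CDK _ _ i j => fun x y => rdK (x i) (x j)
  | CDB _ _ s t => fun x y => rdB (ctval x y s) (ctval x y t)
  | CConn _ _ _ u ps => fun x y => u (\row_i cval (ps i) x y)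
  | CSupK _ _ p => fun x y => sup (range (fun a => cval p (scons a x) y))
  | CInfK _ _ p => fun x y => inf (range (fun a => cval p (scons a x) y))
  | CSupB _ _ p => fun x y => sup (range (fun b => cval p x (scons b y)))
  | CInfB _ _ p => fun x y => inf (range (fun b => cval p x (scons b y)))
  end.

(* The condition phi(u, a, w, b) = 0 in the k variables u for random elements
   and the l variables w for events, with parameters a and b in N. *)
Record ccond (R : realType) (L : fo_sig) (N : rstruct R L) (k l : nat) :=
  CCond {
    cc_p : nat;
    cc_q : nat;
    cc_form : cform R L (k + cc_p) (l + cc_q);
    cc_relt : 'I_cc_p -> relt N;
    cc_revt : 'I_cc_q -> revt N }.
Arguments cc_relt {R L N k l} c _.
Arguments cc_revt {R L N k l} c _.

Definition ccond_over (R : realType) (L : fo_sig) (N : rstruct R L) k l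
    (A : set (relt N + revt N)) : set (ccond N k l) :=
  [set c | (forall i, A (inl (cc_relt c i))) /\
           (forall i, A (inr (cc_revt c i)))].

Definition ccond_true (R : realType) (L : fo_sig) (N : rstruct R L) k l
    (c : ccond N k l) (x : 'I_k -> relt N) (y : 'I_l -> revt N) : Prop :=
  cval (cc_form c) (tcat x (cc_relt c)) (tcat y (cc_revt c)) = 0.

Definition r_saturated (R : realType) (L : fo_sig) (N : rstruct R L) : Prop :=
  forall A : set (relt N + revt N), card_lt A [set: relt N + revt N] ->
  forall k l (G : set (ccond N k l)), G `<=` ccond_over A ->
    (forall G0, G0 `<=` G -> finite_set G0 ->
       exists x y, forall c, G0 c -> ccond_true c x y) ->
    exists x y, forall c, G c -> ccond_true c x y.

(** * The randomization theory

    The axioms of Ben Yaacov and Keisler, read in a metric structure, so that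
    events at distance 0 are equal. As usual in continuous logic, an
    existential axiom asserts that an infimum is 0, i.e. it asks for
    approximate witnesses. *)

Definition inf_zero (R : realType) (X : Type) (f : X -> R) : Prop :=
  forall e : R, 0 < e -> exists x, f x < e.

(* [[x = y]] *)
Definition ev_eq (R : realType) (L : fo_sig) (N : rstruct R L)
    (x y : relt N) : revt N :=
  rbrk (eq_form L) (scons x (fun=> y)).

Record models_TR (R : realType) (L : fo_sig) (T : fo_theory L)
    (N : rstruct R L) : Prop := ModelsTR {
  TR_structure : metric_structure N;
  TR_validity : forall n (phi : fo_form L n), valid phi ->
    forall x : 'I_n -> relt N, rbrk phi x = rtop N;
  (* [[phi(x)]] does not depend on the list of variables in which the formula
     phi is written. *)
  TR_variables : forall m n (s : 'I_n -> 'I_m)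
      (phi : fo_form L m) (psi : fo_form L n),
    (forall (M : fo_struct L) (v : 'I_m -> M),
       sat phi v <-> sat psi (fun i => v (s i))) ->
    forall x : 'I_m -> relt N, rbrk phi x = rbrk psi (fun i => x (s i));
  TR_meetC : forall b c : revt N, rmeet b c = rmeet c b;
  TR_joinC : forall b c : revt N, rjoin b c = rjoin c b;
  TR_meetA : forall b c d : revt N, rmeet b (rmeet c d) = rmeet (rmeet b c) d;
  TR_joinA : forall b c d : revt N, rjoin b (rjoin c d) = rjoin (rjoin b c) d;
  TR_joinK : forall b c : revt N, rmeet b (rjoin b c) = b;
  TR_meetK : forall b c : revt N, rjoin b (rmeet b c) = b;
  TR_meetDl : forall b c d : revt N,
    rmeet b (rjoin c d) = rjoin (rmeet b c) (rmeet b d);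
  TR_meetN : forall b : revt N, rmeet b (rneg b) = rbot N;
  TR_joinN : forall b : revt N, rjoin b (rneg b) = rtop N;
  TR_evNot : forall n (phi : fo_form L n) (x : 'I_n -> relt N),
    rbrk (FNot phi) x = rneg (rbrk phi x);
  TR_evOr : forall n (phi psi : fo_form L n) (x : 'I_n -> relt N),
    rbrk (FOr phi psi) x = rjoin (rbrk phi x) (rbrk psi x);
  TR_evAnd : forall n (phi psi : fo_form L n) (x : 'I_n -> relt N),
    rbrk (FAnd phi psi) x = rmeet (rbrk phi x) (rbrk psi x);
  TR_dK : forall x y : relt N, rdK x y = 1 - rmu (ev_eq x y);
  TR_dB : forall b c : revt N,
    rdB b c = rmu (rjoin (rmeet b (rneg c)) (rmeet (rneg b) c));
  TR_fullness : forall n (phi : fo_form L n.+1) (y : 'I_n -> relt N),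
    inf_zero (fun x => rdB (rbrk phi (scons x y)) (rbrk (FEx phi) y));
  TR_event : forall b : revt N,
    inf_zero (fun xy : relt N * relt N => rdB b (ev_eq xy.1 xy.2));
  TR_mu_top : rmu (rtop N) = 1;
  TR_mu_bot : rmu (rbot N) = 0;
  TR_mu_add : forall b c : revt N,
    rmu b + rmu c = rmu (rjoin b c) + rmu (rmeet b c);
  TR_atomless : forall b : revt N,
    inf_zero (fun c => `|rmu (rmeet b c) - rmu b / 2|);
  TR_transfer : forall phi : fo_form L 0, T phi ->
    forall x : 'I_0 -> relt N, rbrk phi x = rtop N }.

Definition r_big_model (U : Type) (R : realType) (L : fo_sig) (T : fo_theory L)
    (N : rstruct R L) : Prop :=
  [/\ models_TR T N, r_saturated N & ([set: relt N + revt N] #= [set: U])].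

(** * Representation by functions on a probability space *)

Section Randomization.
Variables (R : realType) (L : fo_sig) (M : fo_struct L).
Variables (d : measure_display) (Omega : measurableType d).
Variable P : probability Omega R.

Definition atomless : Prop :=
  forall B : set Omega, measurable B -> (0 < P B)%E ->
    exists C, [/\ measurable C, C `<=` B & (0 < P C < P B)%E].

(* [[phi(a)]] *)
Definition event n (phi : fo_form L n) (a : 'I_n -> Omega -> M) : set Omega :=
  [set w | sat phi (fun i => a i w)].

Definition neat_randomization (J : set (Omega -> M)) : Prop :=
  [/\ measure_is_complete P,
      atomless,
      forall E : set Omega, measurable E <->
        exists n (phi : fo_form L n) (a : 'I_n -> Omega -> M),
          (forall i, J (a i)) /\ E = event phi a
    & forall n (theta : fo_form L n.+1) (b : 'I_n -> Omega -> M),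
        (forall i, J (b i)) ->
        exists a, J a /\ event theta (scons a b) = event (FEx theta) b].

(* N is the reduction of the pre-structure formed by J and the measurable
   subsets of Omega, with reduction maps pK and pB; their values outside J and
   outside the measurable sets are irrelevant. As N is a metric structure,
   preservation of distances makes the fibers of pK and pB the classes of
   elements at distance 0. *)
Record reduction (J : set (Omega -> M)) (N : rstruct R L)
    (pK : (Omega -> M) -> relt N) (pB : set Omega -> revt N) : Prop :=
  Reduction {
    red_surjK : forall x, exists2 a, J a & pK a = x;
    red_surjB : forall b, exists2 B, measurable B & pB B = b;
    red_dK : forall a b, J a -> J b ->
      rdK (pK a) (pK b) = fine (P [set w | a w <> b w]);
    red_dB : forall B C, measurable B -> measurable C ->
      rdB (pB B) (pB C) = fine (P (B `+` C));
    red_ev : forall n (phi : fo_form L n) (a : 'I_n -> Omega -> M),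
      (forall i, J (a i)) -> rbrk phi (fun i => pK (a i)) = pB (event phi a);
    red_mu : forall B, measurable B -> rmu (pB B) = fine (P B);
    red_top : rtop N = pB setT;
    red_bot : rbot N = pB set0;
    red_meet : forall B C, measurable B -> measurable C ->
      rmeet (pB B) (pB C) = pB (B `&` C);
    red_join : forall B C, measurable B -> measurable C ->
      rjoin (pB B) (pB C) = pB (B `|` C);
    red_neg : forall B, measurable B -> rneg (pB B) = pB (~` B) }.

(** * Pointwise algebraic independence *)

Variables (K : Type) (rep : K -> Omega -> M).

(* A(w) *)
Definition at_point (A : set K) (w : Omega) : set M :=
  [set rep a w | a in A].

Definition acl_event (A' B' D : set K) : set Omega :=
  [set w | acl (at_point A' w `|` at_point D w) `&`
           acl (at_point B' w `|` at_point D w) = acl (at_point D w)].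

Definition aomega_indep (A C B : set K) : Prop :=
  forall A' B' C' : set K,
    A' `<=` A -> B' `<=` B -> C' `<=` C ->
    countable A' -> countable B' -> countable C' ->
    exists D : set K,
      [/\ countable D, C' `<=` D, D `<=` C,
          measurable (acl_event A' B' D)
        & P (acl_event A' B' D) = 1%E].

End Randomization.

(* Main.v *)
(** The relation is not base monotone, so the countable sets [D] obtained for
    the various finite subsets of [A'] cannot simply be united. Enumerate
    [A'], let [A_n] consist of the first [n] elements, and choose
    [C' = D_0], [D_(n+1)] containing [D_n] and working for [A_n] against
    [B']. Put [D = \bigcup_n D_n]. For almost every point all the countably
    many equalities for the [A_n] hold at once; at such a point an element of
    the intersection of the closures of [A'] and [B'] over [D] already lies,
    the closure being finitary, in the closures of [A_n] and [B'] over
    [D_(n+1)] for some [n], hence in the closure of [D]. *)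
Require Import Defs.
From HB Require Import structures.
From mathcomp Require Import all_boot all_order all_algebra.
From mathcomp Require Import all_classical all_reals all_analysis.
Local Open Scope classical_set_scope.
Local Open Scope ring_scope.

Section AlgebraicClosure.
Context {L : fo_sig} {M : fo_struct L}.

Lemma acl_subset (X Y : set M) : X `<=` Y -> acl X `<=` acl Y.
Proof.
move=> XY x [p [pX px fp]]; exists p; split=> // i.
exact: XY.
Qed.

(** A formula witnessing algebraicity has finitely many parameters; along an increasing chain they
    all lie in the member with the largest index needed. *)
Lemma acl_bigcup (F : nat -> set M) :
  {homo F : m n / (m <= n)%N >-> m `<=` n} ->
  acl (\bigcup_n F n) = \bigcup_n acl (F n).
Proof.
move=> homoF; apply/seteqP; split; last first.
  by apply: bigcup_sub => n _; apply: acl_subset; exact: bigcup_sup.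
move=> x [p [pF px fp]].
have [k Fk] : {k : 'I_(pf_arity p) -> nat & forall i, F (k i) (pf_par p i)}.
  by apply: (@choice _ _ (fun i n => F n (pf_par p i))) => i;
    have [n _ Fn] := pF i; exists n.
exists (\max_i k i)%N => //; exists p; split=> // i.
by have := Fk i; apply: homoF; apply: leq_bigmax.
Qed.

Lemma acl_cap_bigcup (A B D : nat -> set M) :
  {homo A : m n / (m <= n)%N >-> m `<=` n} ->
  {homo B : m n / (m <= n)%N >-> m `<=` n} ->
  {homo D : m n / (m <= n)%N >-> m `<=` n} ->
  (forall n, acl (A n `|` D n) `&` acl (B n `|` D n) = acl (D n)) ->
  acl (\bigcup_n A n `|` \bigcup_n D n) `&`
    acl (\bigcup_n B n `|` \bigcup_n D n) = acl (\bigcup_n D n).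
Proof.
move=> homoA homoB homoD indep; apply/seteqP; split; last first.
  by rewrite subsetI; split; apply: acl_subset => x Dx; right.
have homoU X : {homo X : m n / (m <= n)%N >-> m `<=` n} ->
    {homo (fun n => X n `|` D n) : m n / (m <= n)%N >-> m `<=` n}.
  by move=> homoX m n mn; apply: setUSS; [exact: homoX|exact: homoD].
rewrite -!bigcupU !acl_bigcup //; try exact: homoU.
move=> x [[m _ Am] [n _ Bn]]; exists (maxn m n) => //.
rewrite -indep; split.
  by apply: (acl_subset _ _ _ _ Am); apply: (homoU _ homoA); exact: leq_maxl.
by apply: (acl_subset _ _ _ _ Bn); apply: (homoU _ homoB); exact: leq_maxr.
Qed.

End AlgebraicClosure.

(** The complement of [E] lies in a countable union of null sets, so it is negligible, and
    completeness of [P] makes it measurable. An inclusion of almost sure events in [E] thus settles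
    measurability as well as probability. *)
Lemma complete_probability1_bigcap (R : realType) (d : measure_display)
    (Omega : measurableType d) (P : probability Omega R)
    (F : nat -> set Omega) (E : set Omega) :
  measure_is_complete P ->
  (forall n, measurable (F n)) -> (forall n, P (F n) = 1%E) ->
  \bigcap_n F n `<=` E -> measurable E /\ P E = 1%E.
Proof.
move=> cP mF PF FE.
have negE : P.-negligible (~` E).
  apply: (@negligibleS _ _ _ _ (\bigcup_n ~` F n)).
    by rewrite -setC_bigcap; exact: subsetC.
  apply: negligible_bigcup => n; exists (~` F n); split=> //.
    exact: measurableC.
  by apply: etrans (probability_setC P (mF n)) _; rewrite PF subee.
have mE := cP _ negE.
have /measurableC := mE; rewrite setCK => mE'; split=> //.
have := probability_setC P mE; rewrite setCK => ->.
by move/negligibleP : negE => ->//; rewrite sube0.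
Qed.

Section Chain.
Context {K : Type}.

Lemma countable_bigcup_finite (A : set K) : countable A ->
  exists F : nat -> set K,
    [/\ {homo F : m n / (m <= n)%N >-> m `<=` n},
        forall n, finite_set (F n) & \bigcup_n F n = A].
Proof.
move=> /countable_injP[f injf].
exists (fun n => A `&` [set x | (f x < n)%N]); split.
- by move=> m n mn x [Ax /= fx]; split=> //; exact: leq_trans mn.
(* [f] maps this set injectively into the numbers below [n]. *)
- move=> n; rewrite -(eq_finite_set (@inj_card_eq _ _ _ f _)).
    by apply: sub_finite_set (finite_II n) => _ [x [_ fx] <-].
  by move=> x y /set_mem[Ax _] /set_mem[Ay _]; apply: injf; exact: mem_set.
- apply/seteqP; split=> [x [n _ []]//|x Ax].
  by exists (f x).+1 => //; split=> //=.
Qed.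

(** Dependent choice along a chain: [Q] is the invariant kept throughout, [S n] the requirement met
    at stage [n]. *)
Lemma dependent_chain (Q : set K -> Prop) (S : nat -> set K -> Prop)
    (C : set K) :
  Q C ->
  (forall n X, Q X -> exists Y, [/\ X `<=` Y, Q Y & S n Y]) ->
  exists D : nat -> set K,
    [/\ {homo D : m n / (m <= n)%N >-> m `<=` n}, forall n, C `<=` D n,
        forall n, Q (D n) & forall n, S n (D n)].
Proof.
move=> QC step.
(* The guard [Q] makes this relation total, as [choice] demands; where [Q] fails, any value will
   do. *)
pose good nX Y := Q nX.2 -> [/\ nX.2 `<=` Y, Q Y & S nX.1 Y].
have [g gP] : {g : nat * set K -> set K & forall nX, good nX (g nX)}.
  apply: choice => -[n X]; have [/(step n)[Y ?]|] := pselect (Q X).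
    by exists Y.
  by exists X.
pose D := fix D n := if n is m.+1 then g (m, D m) else C.
have QD n : Q (D n) by elim: n => //= n /(gP (n, _))[].
have homoD : {homo D : m n / (m <= n)%N >-> m `<=` n}.
  apply: homo_leq => [X|Y X Z|n]; [exact: subset_refl|exact: subset_trans|].
  by have [] := gP (n, D n) (QD n).
(* [S n] is secured in passing from [D n] to [D n.+1], and the start [C] need meet no requirement;
   hence the shift. *)
exists (fun n => D n.+1); split=> // [m n mn|n|n].
- exact: homoD.
- exact: (homoD 0%N).
- by have [] := gP (n, D n) (QD n).
Qed.

End Chain.

Lemma acl_event_bigcup (L : fo_sig) (M : fo_struct L) (d : measure_display)
    (Omega : measurableType d) (K : Type) (rep : K -> Omega -> M)
    (A D : nat -> set K) (B : set K) :
  {homo A : m n / (m <= n)%N >-> m `<=` n} ->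
  {homo D : m n / (m <= n)%N >-> m `<=` n} ->
  \bigcap_n acl_event rep (A n) B (D n) `<=`
    acl_event rep (\bigcup_n A n) B (\bigcup_n D n).
Proof.
move=> homoA homoD w indep; rewrite /acl_event/= /at_point !image_bigcup.
(* The fixed side is written as the union of a constant chain, the shape that [acl_cap_bigcup]
   expects. *)
rewrite -[[set rep a w | a in B]](@bigcup_const _ _ [set: nat]); last first.
  by exists 0%N.
apply: acl_cap_bigcup => [m n mn|m n mn|m n mn|n] //=.
- exact: image_subset (homoA _ _ mn).
- exact: image_subset (homoD _ _ mn).
- exact: indep.
Qed.

Lemma aomega_indep_finite_character (R : realType) (L : fo_sig)
    (M : fo_struct L) (d : measure_display) (Omega : measurableType d)
    (P : probability Omega R) (K : Type) (rep : K -> Omega -> M)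
    (A B C : set K) :
  measure_is_complete P ->
  (forall A0 : set K, A0 `<=` A -> finite_set A0 ->
     aomega_indep P rep A0 C B) ->
  aomega_indep P rep A C B.
Proof.
move=> cP indep A' B' C' A'A B'B C'C cA' cB' cC'.
have [F [homoF finF FA']] := countable_bigcup_finite _ cA'.
have FA n : F n `<=` A.
  by apply: subset_trans A'A; rewrite -FA'; exact: bigcup_sup.
have [|D [homoD C'D QD SD]] := @dependent_chain K
    (fun X => countable X /\ X `<=` C)
    (fun n X => measurable (acl_event rep (F n) B' X) /\
                P (acl_event rep (F n) B' X) = 1%E) C' (conj cC' C'C).
  move=> n X [cX XC].
  (* The set [X] built so far takes the place of [C'] in the definition of independence, so the new
     set [Y] extends it. *)
  have [Y [cY XY YC mY PY]] := indep (F n) (FA n) (finF n) (F n) B' X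
    (@subset_refl _ _) B'B XC (finite_set_countable (finF n)) cB' cX.
  by exists Y.
have [mE PE] : measurable (acl_event rep A' B' (\bigcup_n D n)) /\
    P (acl_event rep A' B' (\bigcup_n D n)) = 1%E.
  apply: (@complete_probability1_bigcap _ _ _ _
    (fun n => acl_event rep (F n) B' (D n))) => // [n|n|].
  - by have [] := SD n.
  - by have [] := SD n.
  - by rewrite -FA'; exact: acl_event_bigcup.
exists (\bigcup_n D n); split=> //.
- by apply: bigcup_countable => // n _; have [] := QD n.
- by apply: subset_trans (C'D 0%N) _; exact: bigcup_sup.
- by apply: bigcup_sub => n _; have [] := QD n.
Qed.

Theorem theorem7p5
  (R : realType)
  (U : Type) (hU : uncountable_inaccessible U)
  (L : fo_sig) (hL : countable_sig L)
  (T : fo_theory L) (hT : complete_theory T)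
  (hT1 : forall M0 : fo_struct L, models M0 T -> exists x y : M0, x <> y)
  (M : fo_struct L) (hM : fo_big_model U T M)
  (N : rstruct R L) (hN : r_big_model U T N)
  (d : measure_display) (Omega : measurableType d) (P : probability Omega R)
  (J : set (Omega -> M)) (hJ : neat_randomization P J)
  (pK : (Omega -> M) -> relt N) (pB : set Omega -> revt N)
  (hred : reduction P J pK pB)
  (rep : relt N -> Omega -> M)
  (hrep : forall a : relt N, J (rep a) /\ pK (rep a) = a)
  (A B C : set (relt N))
  (hA : small U A) (hB : small U B) (hC : small U C) :
  (forall A0 : set (relt N), A0 `<=` A -> finite_set A0 ->
     aomega_indep P rep A0 C B) ->
  aomega_indep P rep A C B.
Proof.
move=> finA; have [cP _ _ _] := hJ.
exact: aomega_indep_finite_character.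
Qed.
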